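(* For every integer $n \geq 5$, $\mathrm{sa}(Q_n) \leq \lceil n/2 \rceil + \lfloor \log_2 n \rfloor - 1$.
   Context: $Q_n$ denotes the $n$-dimensional hypercube: the graph whose vertices are all binary vectors of length $n$, two vertices being adjacent if and only if they differ in exactly one coordinate. A star is a complete bipartite graph $K_{1,m}$ with $m\ge 1$. A galaxy (star forest) is a union of vertex-disjoint stars. The star arboricity $\mathrm{sa}(G)$ of a finite simple graph $G$ is the minimum number of galaxies (subgraphs of $G$) whose edge sets partition the edge set of $G$. *)

(* Defs.v *)
From mathcomp Require Import all_boot.

Set Implicit Arguments.
Unset Strict Implicit.
Unset Printing Implicit Defensive.

Record sgraph := SGraph {
  vertex :> finType;
  adj : rel vertex;
  adj_sym : symmetric adj;
  adj_irr : irreflexive adj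
}.

Definition edges (G : sgraph) : {set {set G}} :=
  [set [set u.1; u.2] | u : G * G & adj u.1 u.2].

(* Stars and galaxies have no isolated vertex, so they are represented by their
   edge sets; the vertex set of S : {set {set T}} is then cover S. *)

Definition star_edges (T : finType) (c : T) (L : {set T}) : {set {set T}} :=
  [set [set c; x] | x in L].

(* K_{1,m} with m = #|L| >= 1. *)
Definition is_star (T : finType) (S : {set {set T}}) : bool :=
  [exists c : T, exists L : {set T},
     [&& L != set0, c \notin L & S == star_edges c L]].

Definition is_galaxy (T : finType) (F : {set {set T}}) : bool :=
  [exists P : {set {set {set T}}},
     [&& [forall S in P, is_star S],
         [forall S1 in P, forall S2 in P,
            (S1 != S2) ==> [disjoint cover S1 & cover S2]]
       & F == cover P]].

(* The library predicate partition excludes empty blocks; this does not affect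
   the minimum below, since empty galaxies can be discarded. *)
Definition galaxy_partition (G : sgraph) (P : {set {set {set G}}}) : bool :=
  partition P (edges G) && [forall F in P, is_galaxy F].

Lemma galaxy_partition_ex (G : sgraph) :
  exists k, [exists P : {set {set {set G}}},
               galaxy_partition P && (#|P| == k)].
Proof.
pose P : {set {set {set G}}} := [set [set e] | e in edges G].
exists #|P|; apply/existsP; exists P; rewrite eqxx andbT.
apply/andP; split; first apply/and3P; first split.
- apply/eqP/setP=> e; apply/bigcupP/idP => [[_ /imsetP[f fE ->]]|eE].
    by rewrite inE => /eqP->.
  by exists [set e]; rewrite ?set11 ?imset_f.
- apply/trivIsetP=> _ _ /imsetP[e _ ->] /imsetP[f _ ->] nef.
  rewrite -setI_eq0; apply/eqP/setP=> x; rewrite !inE.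
  by apply/negP=> /andP[/eqP-> /eqP ef]; rewrite ef eqxx in nef.
- by apply/imsetP=> -[e _ /setP/(_ e)]; rewrite !inE eqxx.
apply/forall_inP=> _ /imsetP[_ /imsetP[[x y] /= xy ->] ->].
apply/existsP; exists [set [set [set x; y]]]; apply/and3P; split.
- apply/forall_inP=> _ /set1P->; apply/existsP; exists x.
  apply/existsP; exists [set y]; apply/and3P; split.
  + by apply/set0Pn; exists y; rewrite set11.
  + apply/negP=> /set1P exy; move: xy.
    by rewrite inE /= exy adj_irr.
  + by rewrite /star_edges imset_set1.
- by apply/forall_inP=> _ /set1P->; apply/forall_inP=> _ /set1P->; rewrite eqxx.
- by rewrite /cover big_set1.
Qed.

Definition star_arboricity (G : sgraph) : nat := ex_minn (galaxy_partition_ex G).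

Definition cube_adj (n : nat) (x y : n.-tuple bool) : bool :=
  #|[set i | tnth x i != tnth y i]| == 1.

Lemma cube_adj_sym n : symmetric (@cube_adj n).
Proof.
by move=> x y; rewrite /cube_adj; congr (#|pred_of_set _| == 1);
  apply/setP=> i; rewrite !inE eq_sym.
Qed.

Lemma cube_adj_irr n : irreflexive (@cube_adj n).
Proof.
by move=> x; apply/eqP=> /eqP/cards1P[i /setP/(_ i)]; rewrite !inE !eqxx.
Qed.

Definition hypercube (n : nat) : sgraph :=
  SGraph (@cube_adj_sym n) (@cube_adj_irr n).

(* Main.v *)
Require Import Defs.
From mathcomp Require Import all_boot.
From mathcomp Require Import all_algebra zify.

Set Implicit Arguments.
Unset Strict Implicit.
Unset Printing Implicit Defensive.

Import GRing.Theory.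

(** A galaxy decomposition is encoded by choosing, for every edge, a colour (its
    galaxy) and one end as its centre.  The colour classes are galaxies as soon
    as two edges of the same colour meeting at a vertex both have that vertex as
    their centre: then no vertex is a leaf of two edges, or both a leaf and a
    centre, in one colour ([star_arboricity_le_colours]).

    In a cube an edge is a vertex together with a direction, so one can colour
    the edges along a set of directions only.  Using disjoint sets of colours
    for two sets of directions shows that the number of colours is subadditive
    in the number of directions ([all_colourable_add]).

    Two colourings are fed into this.  Both come from labelling the vertices by
    a linear map to F_2^m, so that moving in direction i adds a fixed vector
    h i to the label.

    - 2 (2^m - 1) directions need at most 2^m colours ([all_colourable_pow2]).
      Every nonzero vector is used as h i for at most two directions i, i', and
      an edge gets the label of its centre as its colour.  The label of a
      neighbour of y differs from the label of y, and two neighbours have the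
      same label only when they are reached in two such directions i, i'.  So
      it suffices that y is the leaf of only one of these two edges.  The
      directions i, i' span disjoint 4-cycles; orienting each of them
      cyclically does it.

    - 10 directions need at most 7 colours ([all_colourable_10]).  With
      F_2^3 the first construction serves 14 directions with 8 colours; giving
      up four directions leaves enough room to distribute the edges at label 0,
      always with the vertex labelled 0 as centre, over the seven other colours.

    Let 2^k <= n < 2^(k+1).  If n >= 2^(k+1) - 3, then the first colouring with
    m = k, and one extra direction if n = 2^(k+1) - 1, already gives the
    bound; this covers n = 5, 6, 7.  Otherwise k >= 3.  Splitting off
    2^k - 2 directions costs 2^(k-1) colours, one more than half the number of
    directions, and leaves r < 2^k - 1 directions, where log r has dropped by
    at least one: this is exactly what the bound allows ([all_colourable_bound]).
    If r < 5 the induction hypothesis is not available, and r colours are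
    enough except for r = 4, k = 3, that is n = 10. *)

(** * From coloured and oriented edges to galaxies *)

Section GalaxyColouring.

Variables (G : sgraph) (k : nat) (col : G -> G -> 'I_k) (centre : rel G).
Hypothesis colC : forall x y, adj x y -> col x y = col y x.
Hypothesis centreC : forall x y, adj x y -> centre y x = ~~ centre x y.
Hypothesis col_centre : forall x y z,
  adj x y -> adj x z -> y != z -> col x y = col x z -> centre x y.

Let leaves g x := [set y | [&& adj x y, col x y == g & centre x y]].
Let galaxy g : {set {set G}} :=
  [set [set u.1; u.2] | u : G * G & adj u.1 u.2 && (col u.1 u.2 == g)].

(** A common vertex would be both a centre and a leaf, or a leaf of both
    centres.  Either way two edges of colour [g] meet at a vertex that is not
    the centre of both of them. *)
Lemma leaves_disjoint g x x' : x != x' -> leaves g x != set0 ->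
  leaves g x' != set0 ->
  [disjoint x |: leaves g x & x' |: leaves g x'].
Proof.
have adjC (u v : G) : adj u v = adj v u by exact: adj_sym.
have not_leaf u v : leaves g u != set0 -> u \notin leaves g v.
  case/set0Pn=> y; rewrite inE => /and3P[uy /eqP cuy ouy].
  apply/negP; rewrite inE => /and3P[vu /eqP cvu ovu].
  have uv : adj u v by rewrite adjC.
  have [yv|yv] := eqVneq y v.
    by move: ouy; rewrite yv centreC // ovu.
  have := @col_centre u v y uv uy; rewrite eq_sym yv colC // cvu cuy.
  by move=> /(_ isT erefl); rewrite centreC // ovu.
move=> xx' nx nx'; rewrite -setI_eq0; apply/eqP/setP=> z.
rewrite in_setI in_set0; apply/negP=> /andP[].
rewrite in_setU1 => /orP[/eqP->|zx].
  by rewrite in_setU1 (negPf xx') (negPf (not_leaf _ _ nx)).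
rewrite in_setU1 => /orP[/eqP zx'|zx'].
  by move: (not_leaf _ x nx'); rewrite -zx' zx.
move: zx zx'; rewrite !inE => /and3P[xz /eqP cx ox] /and3P[x'z /eqP cx' ox'].
have zx : adj z x by rewrite adjC.
have zx' : adj z x' by rewrite adjC.
have := @col_centre z x x' zx zx' xx'.
by rewrite colC // cx colC // cx' => /(_ erefl); rewrite centreC // ox.
Qed.

(** The stars are indexed by the vertices that are the centre of at least one
    edge of colour [g]. *)
Lemma is_galaxy_colour g : is_galaxy (galaxy g).
Proof.
have cov x : cover (star_edges x (leaves g x)) \subset x |: leaves g x.
  apply/bigcupsP=> _ /imsetP[y yl ->]; apply/subsetP=> z.
  by rewrite !in_set2 in_setU1 => /orP[->//|/eqP->]; rewrite yl orbT.
apply/existsP.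
exists [set star_edges x (leaves g x) | x : G & leaves g x != set0].
apply/and3P; split.
- apply/forall_inP=> S /imsetP[x]; rewrite inE => nx ->.
  apply/existsP; exists x; apply/existsP; exists (leaves g x).
  by rewrite nx eqxx andbT /= inE adj_irr.
- apply/forall_inP=> S /imsetP[x]; rewrite inE => nx ->.
  apply/forall_inP=> S' /imsetP[y]; rewrite inE => ny ->.
  apply/implyP=> nxy; have xy : x != y by apply: contraNneq nxy => ->.
  apply: disjointWl (cov _) _; apply: disjointWr (cov _) _.
  exact: leaves_disjoint.
- apply/eqP/setP=> e; apply/imsetP/bigcupP.
    case=> -[x y]; rewrite inE /= => /andP[xy cxy] ->.
    have [oxy|oxy] := boolP (centre x y).
      have yl : y \in leaves g x by rewrite inE xy cxy oxy.
      exists (star_edges x (leaves g x)); last exact: imset_f.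
      by apply: imset_f; rewrite inE; apply/set0Pn; exists y.
    have xl : x \in leaves g y.
      by rewrite inE adj_sym xy -colC // cxy centreC.
    exists (star_edges y (leaves g y)).
      by apply: imset_f; rewrite inE; apply/set0Pn; exists x.
    by rewrite setUC; apply: imset_f.
  case=> _ /imsetP[x _ ->] /imsetP[y yl ->].
  move: yl; rewrite inE => /and3P[xy cxy _].
  by exists (x, y); rewrite // inE /= xy cxy.
Qed.

Lemma star_arboricity_le_colours : star_arboricity G <= k.
Proof.
pose P := [set galaxy g | g : 'I_k] :\ set0.
suff PP : galaxy_partition P.
  rewrite /star_arboricity; case: ex_minnP => m _ /(_ #|P|) le_m.
  apply: leq_trans (le_m _) _.
    by apply/existsP; exists P; rewrite PP eqxx.
  apply: leq_trans (subset_leq_card (subD1set _ _)) _.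
  by apply: leq_trans (leq_imset_card _ _) _; rewrite card_ord.
apply/andP; split; last first.
  by apply/forall_inP=> _ /setD1P[_ /imsetP[g _ ->]]; apply: is_galaxy_colour.
apply/and3P; split; last by rewrite setD11.
- apply/eqP/setP=> e; apply/bigcupP/imsetP.
    case=> _ /setD1P[_ /imsetP[g _ ->]] /imsetP[[x y]].
    by rewrite inE /= => /andP[xy _] ->; exists (x, y); rewrite ?inE.
  case=> -[x y]; rewrite inE /= => xy ->.
  have eg : [set x; y] \in galaxy (col x y).
    by apply/imsetP; exists (x, y); rewrite // inE /= xy eqxx.
  exists (galaxy (col x y)) => //; rewrite !inE imset_f // andbT.
  by apply/set0Pn; exists [set x; y].
- apply/trivIsetP=> _ _ /setD1P[_ /imsetP[g _ ->]] /setD1P[_ /imsetP[h _ ->]].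
  move=> ngh; have {ngh} gh : g != h by apply: contraNneq ngh => ->.
  rewrite -setI_eq0; apply/eqP/setP=> e; rewrite in_setI in_set0.
  apply/negP=> /andP[/imsetP[[x y]]].
  rewrite inE /= => /andP[xy /eqP cxy] -> /imsetP[[z t]].
  rewrite inE /= => /andP[zt /eqP czt] E.
  have zxy : z \in [set x; y] by rewrite E set21.
  have txy : t \in [set x; y] by rewrite E set22.
  have nzt : z != t by apply: contraTneq zt => ->; rewrite adj_irr.
  move: gh; rewrite -cxy -czt.
  case/set2P: zxy => ?; case/set2P: txy => ?; subst; rewrite ?eqxx // in nzt *.
  by rewrite colC // eqxx.
Qed.

End GalaxyColouring.

(** * Ten directions with seven galaxies: the labels *)

Local Open Scope ring_scope.

Local Notation octal := (bool * bool * bool)%type.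

Definition octal_val (a : octal) : nat := (4 * a.1.1 + 2 * a.1.2 + a.2)%N.

(** The vectors that occur twice are the nonzero ones of a plane, so that the
    edges along the other vectors form a bipartite graph between 4..7 and 0..3,
    which is easy to orient. *)
Definition ten_step (s : nat) : octal :=
  nth 0 [:: (false, false, true); (false, false, true);
            (false, true, false); (false, true, false);
            (false, true, true); (false, true, true);
            (true, false, false); (true, false, true);
            (true, true, false); (true, true, true)] s.

(** Among nonzero labels, the directions with a vector in 4..7 join every label
    t in 4..7 to every label in 1..3.  For each t one of these edges, the one to
    [spare t], is given centre t; the others have their centre in 1..3. *)
Definition spare (t : nat) : nat := nth 0 [:: 1; 1; 2; 3] (t - 4)%N.

(** A vertex labelled 0 is the centre of all its edges.  The two edges between
    nonzero labels u and w along a vector that occurs twice get opposite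
    centres. *)
Definition ten_centre (a : octal) (s : nat) : bool :=
  let u := octal_val a in
  let w := octal_val (a + ten_step s) in
  if u == 0%N then true else if w == 0%N then false
  else if (s < 6)%N then (u < w)%N (+) odd s
  else if (u < w)%N then spare w != u else spare u == w.

(** The centres in galaxy g, for g = 1, ..., 7, are the vertices labelled 0 or
    g.  An edge between nonzero labels must take the label of its centre, so a
    vertex labelled b is then a leaf of galaxy g unless b is itself the centre
    of the only edge joining b and g, and those galaxies are available for the
    edges that join b to label 0.  For b in 4..7 there is one such edge, and the
    available galaxy is [spare b].  For b in 1..3 there are two such edges, and
    the galaxies g in 4..7 with [spare g != b] are available; the table selects
    two of them. *)
Definition ten_colour (a : octal) (s : nat) : nat :=
  let u := octal_val a in
  let w := octal_val (a + ten_step s) in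
  if (u == 0%N) || (w == 0%N) then nth 0 [:: 6; 7; 5; 7; 5; 6; 1; 1; 2; 3] s
  else if ten_centre a s then u else w.

(** The conditions for a colouring depend on the label alone, which leaves
    eight vertices to inspect. *)
Lemma ten_colouring_check (a : octal) :
  all (fun s =>
    [&& (0 < ten_colour a s < 8)%N,
        ten_colour (a + ten_step s) s == ten_colour a s,
        ten_centre (a + ten_step s) s == ~~ ten_centre a s
      & all (fun t => (s != t) ==> (ten_colour a s == ten_colour a t) ==>
                        ten_centre a s) (iota 0 10)])
    (iota 0 10).
Proof. by case: a => [[[] []] []]; vm_compute. Qed.

Local Close Scope ring_scope.

(** * Colouring the edges of a cube along given directions *)

Section CubeColouring.

Variable N : nat.
Local Notation cube := (N.-tuple bool).
Implicit Types (x y : cube) (i j : 'I_N) (D : {set 'I_N}).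

Definition flip x i : cube := [tuple tnth x j (+) (j == i) | j < N].

(** The edge at [x] in direction [i] is also the edge at [flip x i] in direction
    [i]; its colour has to agree at both ends, and exactly one end is its
    centre. *)
Definition colourable D k : Prop :=
  exists (col : cube -> 'I_N -> nat) (centre : cube -> 'I_N -> bool),
  [/\ forall x i, i \in D -> col x i < k,
      forall x i, i \in D -> col (flip x i) i = col x i,
      forall x i, i \in D -> centre (flip x i) i = ~~ centre x i
    & forall x i j, i \in D -> j \in D -> i != j -> col x i = col x j ->
        centre x i].

Definition all_colourable n k : Prop := forall D, #|D| <= n -> colourable D k.

Lemma cube_adjP x y : reflect (exists i, y = flip x i) (cube_adj x y).
Proof.
apply: (iffP cards1P) => -[i Di]; exists i.
  apply: eq_from_tnth => j; rewrite tnth_mktuple.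
  have := congr1 (fun A : {set _} => j \in A) Di; rewrite !inE => <-.
  by case: (tnth x j) (tnth y j) => -[].
apply/setP=> j; rewrite !inE Di tnth_mktuple.
by case: (tnth x j) (j == i) => -[].
Qed.

Lemma star_arboricity_hypercube k :
  0 < N -> all_colourable N k -> star_arboricity (hypercube N) <= k.
Proof.
move=> N0 /(_ [set: 'I_N]); rewrite cardsT card_ord leqnn => /(_ isT).
case=> col [cen [colk colC cenC colcen]].
pose i0 : 'I_N := Ordinal N0.
(* [i0] is a default for equal vertices. *)
pose dir x y := odflt i0 [pick i | tnth x i != tnth y i].
have dirF x i : dir x (flip x i) = i.
  rewrite /dir; case: pickP => [j|/(_ i)]; rewrite tnth_mktuple.
    by have [->|] := eqVneq j i => //; rewrite addbF eqxx.
  by rewrite eqxx; case: (tnth x i).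
have flipK x i : flip (flip x i) i = x.
  by apply: eq_from_tnth => j; rewrite !tnth_mktuple addbK.
have dirFC x i : dir (flip x i) x = i by rewrite -{2}(flipK x i) dirF.
pose c x y : 'I_k := Ordinal (colk x (dir x y) (in_setT _)).
apply: (@star_arboricity_le_colours (hypercube N) k c
  (fun x y => cen x (dir x y))).
- move=> x _ /cube_adjP[i ->]; apply: val_inj.
  by rewrite /= dirF dirFC colC // inE.
- by move=> x _ /cube_adjP[i ->]; rewrite dirF dirFC cenC // inE.
- move=> x _ _ /cube_adjP[i ->] /cube_adjP[j ->] nij [].
  rewrite !dirF => cij; apply: (colcen x i j) => //; rewrite ?inE //.
  by apply: contraNneq nij => ->.
Qed.

Lemma colourable_union D1 D2 k1 k2 :
  colourable D1 k1 -> colourable D2 k2 -> colourable (D1 :|: D2) (k1 + k2).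
Proof.
move=> [c1 [o1 [b1 cC1 oC1 co1]]] [c2 [o2 [b2 cC2 oC2 co2]]].
have D2E i : i \in D1 :|: D2 -> i \notin D1 -> i \in D2.
  by rewrite inE => /orP[->|].
exists (fun x i => if i \in D1 then c1 x i else k1 + c2 x i).
exists (fun x i => if i \in D1 then o1 x i else o2 x i).
split=> [x i|x i|x i|x i j] /D2E iD.
- case: ifPn => [/b1|/iD/b2] /(_ x) b; first exact: ltn_addr.
  by rewrite ltn_add2l.
- by case: ifPn => [/cC1|/iD/cC2] ->.
- by case: ifPn => [/oC1|/iD/oC2] ->.
move=> /D2E jD nij.
case: ifPn => [iD1|/iD iD2]; case: ifPn => [jD1|/jD jD2] cij.
- exact: co1 cij.
- by have := b1 x _ iD1; rewrite cij ltnNge leq_addr.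
- by have := b1 x _ jD1; rewrite -cij ltnNge leq_addr.
- by apply: (co2 x i j) => //; apply: addnI cij.
Qed.

Lemma all_colourable_le n k m l :
  m <= n -> k <= l -> all_colourable n k -> all_colourable m l.
Proof.
move=> mn kl nk D Dm; have [c [o [b cC oC co]]] := nk D (leq_trans Dm mn).
by exists c, o; split=> // x i iD; apply: leq_trans (b x i iD) kl.
Qed.

Lemma all_colourable_add n1 k1 n2 k2 :
  all_colourable n1 k1 -> all_colourable n2 k2 ->
  all_colourable (n1 + n2) (k1 + k2).
Proof.
move=> c1 c2 D Dle; pose A := [set i in take n1 (enum D)].
have sAD : A \subset D.
  by apply/subsetP=> i; rewrite inE => /mem_take; rewrite mem_enum.
have cA : #|A| = minn n1 #|D|.
  rewrite cardsE (card_uniqP (take_uniq _ (enum_uniq _))) size_take_min.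
  by rewrite -cardE.
rewrite -(setID D A) (setIidPr sAD); apply: colourable_union.
  by apply: c1; rewrite cA geq_minl.
by apply: c2; rewrite cardsD (setIidPr sAD) cA; lia.
Qed.

(** The edges in a single direction form a perfect matching, so one colour is
    enough whatever the centres are. *)
Lemma all_colourable_1 : all_colourable 1 1.
Proof.
move=> D /card_le1P D1; exists (fun _ _ => 0), (fun x i => tnth x i).
split=> // [x i _|x i j iD jD].
  by rewrite tnth_mktuple eqxx addbT.
by have := D1 _ iD j; rewrite jD inE => /esym/eqP->; rewrite eqxx.
Qed.

(** * Colourings obtained from vertex labels *)

Local Open Scope ring_scope.

Definition label (V : zmodType) D (h : 'I_N -> V) x : V :=
  \sum_(j in D) h j *+ tnth x j.

Lemma label_flip (V : zmodType) D (h : 'I_N -> V) x i :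
  (forall v : V, v + v = 0) -> i \in D ->
  label D h (flip x i) = label D h x + h i.
Proof.
move=> addvv iD; rewrite /label !(bigD1 i iD) /= tnth_mktuple eqxx.
rewrite [RHS]addrAC; congr (_ + _).
  by case: (tnth x i); rewrite ?addvv ?add0r.
by apply: eq_bigr => j /andP[_ /negPf nji]; rewrite tnth_mktuple nji addbF.
Qed.

(** Edges are coloured by the label of their centre, and [r] tells the at most
    two directions with the same vector apart.  The parity [par x i] over the
    directions that share the vector [h i] changes along each such direction, so
    [r i (+) par x i] orients the 4-cycles spanned by two directions with the
    same vector cyclically: each vertex is the centre of exactly one of its two
    edges in them. *)
Lemma colourable_pairing (V : finZmodType) D (h : 'I_N -> V) (r : 'I_N -> bool) :
  (forall v : V, v + v = 0) -> (forall i, i \in D -> h i != 0) ->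
  {in D &, injective (fun i => (h i, r i))} -> colourable D #|V|.
Proof.
move=> addvv hn0 hr_inj.
pose L := label D h.
pose par x i : bool := label D (fun j => h j == h i : bool) x.
pose cen x i := r i (+) par x i.
(* The label of the end of the edge that is its centre. *)
pose col x i := L x + h i *+ ~~ cen x i.
have cenF x i : i \in D -> cen (flip x i) i = ~~ cen x i.
  move=> iD; rewrite /cen /par label_flip //; last by case.
  by rewrite eqxx -addbN; congr (_ (+) _); rewrite -[RHS]addbT.
exists (fun x i => enum_rank (col x i) : nat), cen; split=> //.
- move=> x i iD; rewrite /col cenF // /L label_flip //.
  congr (nat_of_ord (enum_rank _)).
  by case: (cen x i); rewrite ?addr0 // -addrA addvv addr0.
- move=> x i j iD jD nij /val_inj/enum_rank_inj.
  rewrite /col => /addrI; case: (boolP (cen x i)) => //= ci.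
  case: (boolP (cen x j)) => /= cj.
    by move/eqP; rewrite (negPf (hn0 _ iD)).
  rewrite !mulr1n => hij; case/eqP: nij.
  apply: hr_inj => //; congr (_, _) => //.
  move: ci cj; rewrite /cen /par hij.
  by case: (r i) (r j) (label _ _ _) => -[] [].
Qed.

(** Any such set of directions injects into the pairs of a nonzero vector of
    F_2^m and a bit. *)
Lemma all_colourable_pow2 m : all_colourable (2 * (2 ^ m - 1)) (2 ^ m).
Proof.
move=> D Dle; pose V : finZmodType := 'rV['F_2]_m.
have V2 : #|V| = (2 ^ m)%N by rewrite card_mx mul1n card_Fp.
rewrite -V2.
pose S := setX [set~ (0 : V)] [set: bool].
have DS : (#|D| <= #|S|)%N.
  by rewrite cardsX cardsC1 V2 cardsT card_bool mulnC -subn1.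
pose f i := nth (0, false) (enum S) (index i (enum D)).
have idx i : i \in D -> (index i (enum D) < size (enum S))%N.
  by move=> iD; rewrite -cardE (leq_trans _ DS) // cardE index_mem mem_enum.
apply: (@colourable_pairing V D (fun i => (f i).1) (fun i => (f i).2)).
- move=> v; apply/rowP=> i; rewrite !mxE -mulr2n -mulr_natr.
  by rewrite (pchar_Zp (isT : (1 < 2)%N)) mulr0.
- move=> i /idx iS; have := mem_nth (0, false) iS.
  by rewrite mem_enum !inE andbT.
- move=> i j iD jD; rewrite -!surjective_pairing => /eqP.
  rewrite nth_uniq ?idx ?enum_uniq // => /eqP ij.
  by rewrite -[i](nth_index i (_ : i \in enum D)) ?mem_enum // ij
    nth_index ?mem_enum.
Qed.

(** The colouring of the ten labelled directions, numbered in the order in which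
    they occur in [D], pulled back along the labelling.  The colours 1, ..., 7
    are shifted down by one. *)
Lemma all_colourable_10 : all_colourable 10 7.
Proof.
move=> D Dle; pose idx i := index i (enum D).
have idx10 i : i \in D -> idx i \in iota 0 10.
  move=> iD; rewrite mem_iota /= (leq_trans _ Dle) //.
  by rewrite cardE index_mem mem_enum.
have idx_inj i j : i \in D -> j \in D -> i != j -> idx i != idx j.
  move=> iD jD; apply: contraNneq => ij.
  by rewrite -[i](nth_index i (_ : i \in enum D)) ?mem_enum // -/(idx i) ij
    nth_index ?mem_enum.
pose L := label D (fun i => ten_step (idx i)).
have LF x i : i \in D -> L (flip x i) = L x + ten_step (idx i).
  by apply: label_flip; case=> [[[] []] []].
have chk x i (iD : i \in D) := allP (ten_colouring_check (L x)) _ (idx10 i iD).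
exists (fun x i => (ten_colour (L x) (idx i)).-1).
exists (fun x i => ten_centre (L x) (idx i)).
split=> [x i iD|x i iD|x i iD|x i j iD jD nij eqc].
- by case/and4P: (chk x i iD); case: ten_colour.
- by rewrite LF //; case/and4P: (chk x i iD) => _ /eqP->.
- by rewrite LF //; case/and4P: (chk x i iD) => _ _ /eqP->.
case/and4P: (chk x i iD) => /andP[ci _] _ _ /allP/(_ _ (idx10 j jD)).
rewrite idx_inj //=; move/implyP; apply; apply/eqP.
case/and4P: (chk x j jD) => /andP[cj _] _ _ _.
by rewrite -(prednK ci) -(prednK cj) eqc.
Qed.

Local Close Scope ring_scope.

(** * The bound *)

Lemma all_colourable_bound n :
  5 <= n -> all_colourable n (uphalf n + trunc_log 2 n - 1).
Proof.
have c2 : all_colourable 2 2 by exact: (@all_colourable_pow2 1).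
have c3 : all_colourable 3 3.
  by exact: (all_colourable_add (@c2) (@all_colourable_1)).
have c4 : all_colourable 4 4 by exact: (all_colourable_add (@c2) (@c2)).
elim/ltn_ind: n => n IH n5.
have n0 : 0 < n by lia.
have /andP[kn nk] := trunc_log_bounds (isT : 1 < 2) n0.
have k2 : 1 < trunc_log 2 n by apply: trunc_log_max => //; exact: ltnW.
(* p = 2^(k-2), where k is the logarithm of n. *)
case Ek: (trunc_log 2 n) kn nk k2 => [|[|q]] // kn nk _.
rewrite !expnS in kn nk; set p := 2 ^ q in kn nk.
have p0 : 0 < p by rewrite expn_gt0.
have full : all_colourable (8 * p - 2) (4 * p).
  have := @all_colourable_pow2 q.+2; rewrite !expnS -/p.
  by apply: all_colourable_le; lia.
have half : all_colourable (4 * p - 2) (2 * p).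
  have := @all_colourable_pow2 q.+1; rewrite !expnS -/p.
  by apply: all_colourable_le; lia.
(* 4 p <= n < 8 p; for the top three values [full], with one more direction if
   n = 8 p - 1, is already good enough.  This leaves nothing when p = 1. *)
have [n1|n1] := ltnP (8 * p - 2) n.
  by apply: all_colourable_le (all_colourable_add full (@all_colourable_1)); lia.
have [n2|n2] := leqP (8 * p - 3) n.
  by apply: all_colourable_le full; lia.
have q0 : 0 < q by rewrite lt0n; apply: contraTneq n2 => q0; rewrite /p q0; lia.
have [r Er] : exists r, n = (4 * p - 2) + r by exists (n - (4 * p - 2)); lia.
have split l : all_colourable r l -> 2 * p + l <= uphalf n + q.+2 - 1 ->
    all_colourable n (uphalf n + q.+2 - 1).
  by move=> cl le_l; apply: all_colourable_le (all_colourable_add half cl); lia.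
have [r5|r5] := leqP 5 r.
  apply: (split _ (IH r _ r5)); first by lia.
  have : trunc_log 2 r < q.+2.
    rewrite -(@ltn_exp2l 2) //; apply: leq_ltn_trans (trunc_logP _ _) _ => //.
      by lia.
    by rewrite !expnS -/p; lia.
  lia.
have [r2|r2] := eqVneq r 2; first by apply: split; [rewrite r2; exact: c2 | lia].
have [r3|r3] := eqVneq r 3; first by apply: split; [rewrite r3; exact: c3 | lia].
have r4 : r = 4 by lia.
have [q2|q1] := leqP 2 q.
  by apply: split; [rewrite r4; exact: c4 | lia].
have {q1} q1 : q = 1 by lia.
by apply: all_colourable_le (@all_colourable_10); rewrite Er r4 /p q1.
Qed.

End CubeColouring.

Theorem corollary4 (n : nat) (hn : 5 <= n) :
  star_arboricity (hypercube n) <= uphalf n + trunc_log 2 n - 1.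
Proof.
apply: star_arboricity_hypercube; first exact: leq_trans hn.
exact: all_colourable_bound.
Qed.
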